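(* Let $T:V\to\mathfrak{g}$ be an embedding tensor on a 3-Leibniz algebra $(\mathfrak{g},[\cdot,\cdot,\cdot]_{\mathfrak{g}})$ with respect to a representation $(V;\rho^l,\rho^m,\rho^r)$. Then $V$ is a 3-tri-Leibniz algebra with the operations $$[u,v,w]_{\vdash}^T=\rho^l(Tu,Tv,w),\quad [u,v,w]_{\perp}^T=\rho^m(Tu,v,Tw),\quad [u,v,w]_{\dashv}^T=\rho^r(u,Tv,Tw)$$ for all $u,v,w\in V$. Moreover, $T$ is a homomorphism from the 3-tri-Leibniz algebra $(V,[\cdot,\cdot,\cdot]_{\vdash}^T,[\cdot,\cdot,\cdot]_{\perp}^T,[\cdot,\cdot,\cdot]_{\dashv}^T)$ to the 3-Leibniz algebra $(\mathfrak{g},[\cdot,\cdot,\cdot]_{\mathfrak{g}})$, i.e. $T[u,v,w]_{\triangle}^T=[Tu,Tv,Tw]_{\mathfrak{g}}$ for all $u,v,w\in V$ and $\triangle\in\{\vdash,\dashv,\perp\}$.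
   Context: All vector spaces and (multi)linear maps are over a field $\mathbb{K}$ of characteristic zero. 3-Leibniz algebra: a vector space $\mathfrak{g}$ with a trilinear map $[\cdot,\cdot,\cdot]_{\mathfrak{g}}:\mathfrak{g}\times\mathfrak{g}\times\mathfrak{g}\to\mathfrak{g}$ such that $[a,b,[x,y,z]]=[[a,b,x],y,z]+[x,[a,b,y],z]+[x,y,[a,b,z]]$ for all $a,b,x,y,z\in\mathfrak{g}$. It is regarded as a 3-tri-Leibniz algebra (defined below) whose three brackets coincide. Representation of $(\mathfrak{g},[\cdot,\cdot,\cdot]_{\mathfrak{g}})$: a vector space $V$ with trilinear maps $\rho^l:\mathfrak{g}\otimes\mathfrak{g}\otimes V\to V$, $\rho^m:\mathfrak{g}\otimes V\otimes\mathfrak{g}\to V$, $\rho^r:V\otimes\mathfrak{g}\otimes\mathfrak{g}\to V$ such that for all $x,y,z,a,b\in\mathfrak{g}$, $u\in V$ (brackets are those of $\mathfrak{g}$): $\rho^l(a,b,\rho^l(x,y,u))=\rho^l([a,b,x],y,u)+\rho^l(x,[a,b,y],u)+\rho^l(x,y,\rho^l(a,b,u))$; $\rho^l(a,b,\rho^m(x,u,z))=\rho^m([a,b,x],u,z)+\rho^m(x,\rho^l(a,b,u),z)+\rho^m(x,u,[a,b,z])$; $\rho^l(a,b,\rho^r(u,y,z))=\rho^r(\rho^l(a,b,u),y,z)+\rho^r(u,[a,b,y],z)+\rho^r(u,y,[a,b,z])$; $\rho^m(a,u,[x,y,z])=\rho^r(\rho^m(a,u,x),y,z)+\rho^m(x,\rho^m(a,u,y),z)+\rho^l(x,y,\rho^m(a,u,z))$;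 $\rho^r(u,b,[x,y,z])=\rho^r(\rho^r(u,b,x),y,z)+\rho^m(x,\rho^r(u,b,y),z)+\rho^l(x,y,\rho^r(u,b,z))$. Embedding tensor on $\mathfrak{g}$ with respect to $V$: a linear map $T:V\to\mathfrak{g}$ with $[Tu,Tv,Tw]_{\mathfrak{g}}=T\rho^l(Tu,Tv,w)=T\rho^m(Tu,v,Tw)=T\rho^r(u,Tv,Tw)$ for all $u,v,w\in V$. 3-tri-Leibniz algebra: a vector space with three trilinear brackets $[\cdot,\cdot,\cdot]_{\dashv},[\cdot,\cdot,\cdot]_{\perp},[\cdot,\cdot,\cdot]_{\vdash}$ such that for all elements $x,y,z,a,b$ and all choices of $\triangle\in\{\vdash,\dashv,\perp\}$ (each occurrence of $\triangle$ may be chosen independently): (i) $[a,b,[x,y,z]_{\triangle}]_{\dashv}=[[a,b,x]_{\dashv},y,z]_{\dashv}+[x,[a,b,y]_{\dashv},z]_{\perp}+[x,y,[a,b,z]_{\dashv}]_{\vdash}$; (ii) $[a,b,[x,y,z]_{\dashv}]_{\vdash}=[[a,b,x]_{\vdash},y,z]_{\dashv}+[x,[a,b,y]_{\triangle},z]_{\dashv}+[x,y,[a,b,z]_{\triangle}]_{\dashv}$; (iii) $[a,b,[x,y,z]_{\vdash}]_{\vdash}=[[a,b,x]_{\triangle},y,z]_{\vdash}+[x,[a,b,y]_{\triangle},z]_{\vdash}+[x,y,[a,b,z]_{\vdash}]_{\vdash}$; (iv) $[a,b,[x,y,z]_{\perp}]_{\vdash}=[[a,b,x]_{\triangle},y,z]_{\perp}+[x,[a,b,y]_{\vdash},z]_{\perp}+[x,y,[a,b,z]_{\triangle}]_{\perp}$;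 (v) $[a,b,[x,y,z]_{\triangle}]_{\perp}=[[a,b,x]_{\perp},y,z]_{\dashv}+[x,[a,b,y]_{\perp},z]_{\perp}+[x,y,[a,b,z]_{\perp}]_{\vdash}$. *)

(* Defs.v *)
From mathcomp Require Import all_boot all_order all_algebra.

Set Implicit Arguments.
Unset Strict Implicit.
Unset Printing Implicit Defensive.

Import GRing.Theory.
Local Open Scope ring_scope.

Definition trilinear (K : fieldType) (U1 U2 U3 W : lmodType K)
    (f : U1 -> U2 -> U3 -> W) : Prop :=
  [/\ forall y z, linear (fun x => f x y z),
      forall x z, linear (fun y => f x y z)
    & forall x y, linear (fun z => f x y z)].

Record leibniz3 (K : fieldType) (g : lmodType K) (br : g -> g -> g -> g) : Prop :=
  Leibniz3 {
    leibniz3_trilinear : trilinear br;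
    leibniz3_identity : forall a b x y z,
      br a b (br x y z)
      = br (br a b x) y z + br x (br a b y) z + br x y (br a b z)
  }.

Record representation (K : fieldType) (g : lmodType K) (br : g -> g -> g -> g)
    (V : lmodType K)
    (rl : g -> g -> V -> V) (rm : g -> V -> g -> V) (rr : V -> g -> g -> V) : Prop :=
  Representation {
    repr_l_trilinear : trilinear rl;
    repr_m_trilinear : trilinear rm;
    repr_r_trilinear : trilinear rr;
    repr_ll : forall a b x y u,
      rl a b (rl x y u)
      = rl (br a b x) y u + rl x (br a b y) u + rl x y (rl a b u);
    repr_lm : forall a b x u z,
      rl a b (rm x u z)
      = rm (br a b x) u z + rm x (rl a b u) z + rm x u (br a b z);
    repr_lr : forall a b u y z,
      rl a b (rr u y z)
      = rr (rl a b u) y z + rr u (br a b y) z + rr u y (br a b z);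
    repr_m : forall a u x y z,
      rm a u (br x y z)
      = rr (rm a u x) y z + rm x (rm a u y) z + rl x y (rm a u z);
    repr_r : forall u b x y z,
      rr u b (br x y z)
      = rr (rr u b x) y z + rm x (rr u b y) z + rl x y (rr u b z)
  }.

Definition embedding_tensor (K : fieldType) (g : lmodType K)
    (br : g -> g -> g -> g) (V : lmodType K)
    (rl : g -> g -> V -> V) (rm : g -> V -> g -> V) (rr : V -> g -> g -> V)
    (T : {linear V -> g}) : Prop :=
  forall u v w : V,
    [/\ br (T u) (T v) (T w) = T (rl (T u) (T v) w),
        T (rl (T u) (T v) w) = T (rm (T u) v (T w))
      & T (rm (T u) v (T w)) = T (rr u (T v) (T w))].

(* The index set of the three brackets [-,-,-]_vdash, [-,-,-]_perp and
   [-,-,-]_dashv. *)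
Inductive tri := Vdash | Perp | Dashv.

(* The indices d and e range independently over the three brackets. *)
Record tri_leibniz3 (K : fieldType) (A : lmodType K)
    (br : tri -> A -> A -> A -> A) : Prop :=
  TriLeibniz3 {
    tri_leibniz3_trilinear : forall d, trilinear (br d);
    tri_leibniz3_dashv : forall d a b x y z,
      br Dashv a b (br d x y z)
      = br Dashv (br Dashv a b x) y z
        + br Perp x (br Dashv a b y) z
        + br Vdash x y (br Dashv a b z);
    tri_leibniz3_vdash_dashv : forall d e a b x y z,
      br Vdash a b (br Dashv x y z)
      = br Dashv (br Vdash a b x) y z
        + br Dashv x (br d a b y) z
        + br Dashv x y (br e a b z);
    tri_leibniz3_vdash_vdash : forall d e a b x y z,
      br Vdash a b (br Vdash x y z)
      = br Vdash (br d a b x) y z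
        + br Vdash x (br e a b y) z
        + br Vdash x y (br Vdash a b z);
    tri_leibniz3_vdash_perp : forall d e a b x y z,
      br Vdash a b (br Perp x y z)
      = br Perp (br d a b x) y z
        + br Perp x (br Vdash a b y) z
        + br Perp x y (br e a b z);
    tri_leibniz3_perp : forall d a b x y z,
      br Perp a b (br d x y z)
      = br Dashv (br Perp a b x) y z
        + br Perp x (br Perp a b y) z
        + br Vdash x y (br Perp a b z)
  }.

Definition tri_of_leibniz3 (K : fieldType) (g : lmodType K)
    (br : g -> g -> g -> g) : tri -> g -> g -> g -> g := fun=> br.

Lemma leibniz3_tri_leibniz3 (K : fieldType) (g : lmodType K)
    (br : g -> g -> g -> g) :
  leibniz3 br -> tri_leibniz3 (tri_of_leibniz3 br).
Proof. by case=> brL brE; split=> // *; apply: brE. Qed.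

Definition tri_leibniz3_hom (K : fieldType) (A B : lmodType K)
    (brA : tri -> A -> A -> A -> A) (brB : tri -> B -> B -> B -> B)
    (f : {linear A -> B}) : Prop :=
  forall d u v w, f (brA d u v w) = brB d (f u) (f v) (f w).

Definition induced_brackets (K : fieldType) (g V : lmodType K)
    (rl : g -> g -> V -> V) (rm : g -> V -> g -> V) (rr : V -> g -> g -> V)
    (T : {linear V -> g}) (d : tri) (u v w : V) : V :=
  match d with
  | Vdash => rl (T u) (T v) w
  | Perp => rm (T u) v (T w)
  | Dashv => rr u (T v) (T w)
  end.

(* Main.v *)
Require Import Defs.
From mathcomp Require Import all_boot all_order all_algebra.

(** The embedding tensor condition says exactly that T sends each induced
    bracket to the bracket of g: this is the homomorphism property
    ([induced_brackets_hom]).  Each induced bracket has one V-slot, the last one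
    for vdash, the middle one for perp and the first one for dashv, and applies T
    to its other two arguments.  In the identities of a 3-tri-Leibniz algebra the
    nested brackets of prescribed type are precisely those in the V-slot of the
    outer bracket, and the nested brackets of free type are precisely those in
    the other slots.  The latter are seen only through T, which turns
    them into the bracket of g whatever their type: this is why the free types
    may be chosen independently.  What remains of each identity is one axiom
    of the representation, determined by the left-hand side: the outer bracket
    dashv gives [repr_r], perp gives [repr_m], and vdash gives [repr_lr],
    [repr_ll] or [repr_lm] according to the inner bracket. *)

Local Open Scope ring_scope.

Lemma induced_brackets_hom (K : fieldType) (g V : lmodType K)
    (br : g -> g -> g -> g)
    (rl : g -> g -> V -> V) (rm : g -> V -> g -> V) (rr : V -> g -> g -> V)
    (T : {linear V -> g}) :
  embedding_tensor br rl rm rr T ->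
  tri_leibniz3_hom (induced_brackets rl rm rr T) (tri_of_leibniz3 br) T.
Proof.
move=> TE d u v w; have [brl lm mr] := TE u v w.
by case: d; rewrite /tri_of_leibniz3 /= -?mr -?lm brl.
Qed.

Lemma induced_brackets_trilinear (K : fieldType) (g V : lmodType K)
    (rl : g -> g -> V -> V) (rm : g -> V -> g -> V) (rr : V -> g -> g -> V)
    (T : {linear V -> g}) :
  trilinear rl -> trilinear rm -> trilinear rr ->
  forall d, trilinear (induced_brackets rl rm rr T d).
Proof.
move=> [l1 l2 l3] [m1 m2 m3] [r1 r2 r3].
by case; split=> x y a u v /=;
   rewrite ?GRing.linearP ?(l1, l2, l3, m1, m2, m3, r1, r2, r3).
Qed.

Theorem proposition3p10 (K : fieldType) (charK : [pchar K] =i pred0)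
    (g : lmodType K) (br : g -> g -> g -> g) (gL : leibniz3 br)
    (V : lmodType K)
    (rl : g -> g -> V -> V) (rm : g -> V -> g -> V) (rr : V -> g -> g -> V)
    (VR : representation br rl rm rr)
    (T : {linear V -> g}) (TE : embedding_tensor br rl rm rr T) :
  tri_leibniz3 (induced_brackets rl rm rr T) /\
  tri_leibniz3_hom (induced_brackets rl rm rr T) (tri_of_leibniz3 br) T.
Proof.
have Thom := induced_brackets_hom _ _ _ _ _ _ _ _ TE.
split=> //.
have T_ind d u v w :
  T (induced_brackets rl rm rr T d u v w) = br (T u) (T v) (T w) := Thom d u v w.
case: VR => rlL rmL rrL ll lm lr m r.
split; first exact: induced_brackets_trilinear.
- by move=> d a b x y z; rewrite /= T_ind r.
- by move=> d e a b x y z; rewrite /= !T_ind lr.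
- by move=> d e a b x y z; rewrite /= !T_ind ll.
- by move=> d e a b x y z; rewrite /= !T_ind lm.
- by move=> d a b x y z; rewrite /= T_ind m.
Qed.
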